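(* For $d_\bullet$ any of $d_L$, $d_B$, $d_E$ (which coincide on $\mathsf{PDgm}^0$), the death-vectorization map satisfies $$d_\bullet(Y,Y')\le\|\mathrm{DV}(Y)-\mathrm{DV}(Y')\|_\infty\le 2\,d_\bullet(Y,Y')$$ for all $Y,Y'\in\mathsf{PDgm}^0$.
   Context: Let $\mathbb{R}^2_<=\{(b,d)\in\mathbb{R}^2: b<d\}$. A persistence diagram is a finite multiset $Y=\{(b_i,d_i)\}_{i=1}^N$ of points of $\mathbb{R}^2_<$. $\mathsf{PDgm}^0$ is the set of birth-zero persistence diagrams, i.e. those of the form $Y=\{(0,d_i)\}_{i=1}^N$ with $d_1\ge\dots\ge d_N>0$. The death-vectorization map $\mathrm{DV}:\mathsf{PDgm}^0\to\ell^\infty$ is $\mathrm{DV}(\{(0,d_i)\}_{i=1}^N)=(d_1,\dots,d_N,0,0,\dots)$. For $b\le d$, $\mathrm{rank}[Y](b,d)$ is the number (with multiplicity) of $(b_i,d_i)\in Y$ with $b_i\le b\le d<d_i$. The erosion distance $d_E(Y,Y')$ is the infimum of all $\varepsilon\ge0$ such that, for all $b\le d$, $\mathrm{rank}[Y](b-\varepsilon,d+\varepsilon)\le\mathrm{rank}[Y'](b,d)$ and $\mathrm{rank}[Y'](b-\varepsilon,d+\varepsilon)\le\mathrm{rank}[Y](b,d)$. The landscape distance is $d_L(Y,Y')=\sup_{k\in\mathbb{N},t\in\mathbb{R}}|\lambda^Y_k(t)-\lambda^{Y'}_k(t)|$, where $\lambda^Y_k(t)=\sup\{h\ge0:\mathrm{rank}[Y](t-h,t+h)\ge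 k\}$ (supremum of the empty set being $0$; $\mathbb{N}=\{1,2,\dots\}$). The bottleneck distance is $$d_B(Y,Y')=\min_{\phi:S\to S'}\max\left\{\max_{(b,d)\in S}d_\infty((b,d),\phi(b,d)),\ \max_{(b,d)\in Y\setminus S}\tfrac{d-b}{2},\ \max_{(b',d')\in Y'\setminus S'}\tfrac{d'-b'}{2}\right\},$$ the minimum being over bijections $\phi$ between sub-multisets $S\subseteq Y$ and $S'\subseteq Y'$, with $d_\infty((b,d),(b',d'))=\max\{|b-b'|,|d-d'|\}$ and maxima over empty sets equal to $0$. *)

(* Defs.v *)
From HB Require Import structures.
From mathcomp Require Import all_boot all_order all_algebra.
From mathcomp Require Import finmap multiset.
From mathcomp Require Import lra.
From mathcomp Require Import all_classical all_reals all_analysis.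

Set Implicit Arguments.
Unset Strict Implicit.
Unset Printing Implicit Defensive.

Import Order.TTheory GRing.Theory Num.Theory.
Import numFieldNormedType.Exports.

Local Open Scope classical_set_scope.
Local Open Scope mset_scope.
Local Open Scope ring_scope.

Definition R2lt (R : realType) := {p : R * R | p.1 < p.2}.

Definition birth (R : realType) (p : R2lt R) : R := (val p).1.
Definition death (R : realType) (p : R2lt R) : R := (val p).2.

Definition PDgm (R : realType) := {mset R2lt R}.
Identity Coercion PDgm_to_mset : PDgm >-> multiset_of.

(* As the points lie in R2lt, a birth at 0 forces a positive death. *)
Definition PDgm0 (R : realType) : set (PDgm R) :=
  [set Y | forall p, p \in Y -> birth p = 0].

Definition rank (R : realType) (Y : PDgm R) (b d : R) : nat :=
  count (fun p => [&& birth p <= b, b <= d & d < death p]) Y.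

Definition eroded (R : realType) (Y Y' : PDgm R) (e : R) : Prop :=
  forall b d : R, b <= d ->
    (rank Y (b - e) (d + e) <= rank Y' b d)%N /\
    (rank Y' (b - e) (d + e) <= rank Y b d)%N.

Definition erosion_dist (R : realType) (Y Y' : PDgm R) : R :=
  inf [set e : R | 0 <= e /\ eroded Y Y' e].

(* [sup set0 = 0], so the landscape vanishes where no h is admissible. *)
Definition landscape (R : realType) (Y : PDgm R) (k : nat) (t : R) : R :=
  sup [set h : R | 0 <= h /\ (k <= rank Y (t - h)%R (t + h)%R)%N].

(* Only k >= 1 is allowed: for k = 0 the supremum above is over an unbounded
   set. *)
Definition landscape_dist (R : realType) (Y Y' : PDgm R) : R :=
  sup [set `|landscape Y k t - landscape Y' k t|
      | k in [set k : nat | (1 <= k)%N] & t in [set: R]].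

(* The elements of Y, counted with multiplicity, are labelled by
   ['I_(size Y)]; repeated points carry distinct labels. *)
Definition pt (R : realType) (Y : PDgm R) (i : 'I_(size Y)) : R2lt R :=
  tnth (in_tuple Y) i.

Definition dinf (R : realType) (p q : R2lt R) : R :=
  Num.max `|birth p - birth q| `|death p - death q|.

(* A bijection phi : S -> S' between sub-multisets of Y and Y' is encoded as an
   injective partial map on labels: [phi i = Some j] means that the i-th point
   lies in S and is sent to the j-th point of Y'; [phi i = None] means that it
   lies in Y \ S.  The image of phi is S'. *)
Definition is_matching (m n : nat) (phi : {ffun 'I_m -> option 'I_n}) : bool :=
  [forall i, forall i', (phi i == phi i') && (phi i != None) ==> (i == i')].

Definition matching_cost (R : realType) (Y Y' : PDgm R)
    (phi : {ffun 'I_(size Y) -> option 'I_(size Y')}) : R :=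
  Num.max
    (\big[Num.max/0]_(ij : 'I_(size Y) * 'I_(size Y') | phi ij.1 == Some ij.2)
       dinf (pt ij.1) (pt ij.2))
    (Num.max
      (\big[Num.max/0]_(i : 'I_(size Y) | phi i == None)
         ((death (pt i) - birth (pt i)) / 2))
      (\big[Num.max/0]_(j : 'I_(size Y') | Some j \notin codom phi)
         ((death (pt j) - birth (pt j)) / 2))).

(* The empty matching, the default of the iterated minimum, is itself a
   matching, so this is the minimum of the cost over all matchings. *)
Definition bottleneck_dist (R : realType) (Y Y' : PDgm R) : R :=
  \big[Num.min/matching_cost (Y := Y) (Y' := Y') [ffun=> None]]_(
      phi : {ffun 'I_(size Y) -> option 'I_(size Y')} | is_matching phi)
    matching_cost phi.

(* Deaths in nonincreasing order, padded with zeros. *)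
Definition DV (R : realType) (Y : PDgm R) : nat -> R :=
  fun n => nth 0 (sort >=%R [seq death p | p <- Y]) n.

Definition linf_norm (R : realType) (u : nat -> R) : R :=
  sup [set `|u n| | n in [set: nat]].

(* The suprema and infima above are those of nonempty bounded sets, hence never
   take the default value by accident. *)

Lemma DV_bounded (R : realType) (Y : PDgm R) :
  exists M : R, forall n, `|DV Y n| <= M.
Proof.
exists (\sum_(x <- sort >=%R [seq death p | p <- Y]) `|x|) => n.
rewrite /DV; elim: (sort _ _) n => [|x s IH] [|n] //=.
- by rewrite normr0 big_nil.
- by rewrite normr0 big_nil.
- by rewrite big_cons lerDl sumr_ge0.
- by rewrite big_cons (le_trans (IH n))// lerDr.
Qed.

Lemma linf_norm_has_sup (R : realType) (Y Y' : PDgm R) :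
  has_sup [set `|(DV Y \- DV Y') n| | n in [set: nat]].
Proof.
split; first by exists `|(DV Y \- DV Y') 0%N|, 0%N.
have [M MY] := DV_bounded Y; have [M' MY'] := DV_bounded Y'.
exists (M + M') => _ [n _ <-].
by rewrite (le_trans (ler_normB _ _))// lerD.
Qed.

Lemma rank_large (R : realType) (Y : PDgm R) :
  exists2 M : R, 0 <= M & forall b d, M < d - b -> rank Y b d = 0%N.
Proof.
rewrite /rank; elim: (Y : seq _) => [|p s [M M0 IH]]; first by exists 0.
exists (M + `|death p - birth p|); first by rewrite addr_ge0.
move=> b d Mdb /=; rewrite IH; last first.
  by rewrite (le_lt_trans _ Mdb)// lerDl.
rewrite addn0; case: (boolP [&& _, _ & _]) => // /and3P[bb _ dd].
suff : d - b <= M + `|death p - birth p| by rewrite leNgt Mdb.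
rewrite (@le_trans _ _ (death p - birth p))//.
  by rewrite lerD ?lerN2// ltW.
by rewrite (le_trans (ler_norm _))// lerDr.
Qed.

Lemma erosion_has_inf (R : realType) (Y Y' : PDgm R) :
  has_inf [set e : R | 0 <= e /\ eroded Y Y' e].
Proof.
split; last by exists 0 => e [].
have [M M0 HM] := rank_large Y; have [M' M0' HM'] := rank_large Y'.
exists (M + M' + 1); split; first by rewrite !addr_ge0.
move=> b d bd.
split; first by rewrite HM //; lra.
by rewrite HM' //; lra.
Qed.

Lemma landscape_bound (R : realType) (Y : PDgm R) :
  exists M : R, forall k t, (1 <= k)%N ->
    ubound [set h : R | 0 <= h /\ (k <= rank Y (t - h)%R (t + h)%R)%N] M /\
    0 <= landscape Y k t <= M.
Proof.
have [M M0 HM] := rank_large Y; exists M => k t k1.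
have ub : ubound [set h : R | 0 <= h /\ (k <= rank Y (t - h)%R (t + h)%R)%N] M.
  move=> h [h0 kr]; rewrite leNgt; apply/negP => Mh.
  have Mtt : M < t + h - (t - h) by clear -h0 Mh; lra.
  by move: kr; rewrite HM ?Mtt// leqNgt k1.
split=> //; rewrite /landscape; set A := (X in sup X); have uA : ubound A M by [].
have [->|/set0P[h Ah]] := eqVneq A set0; first by rewrite sup0 lexx.
apply/andP; split; last by apply: ge_sup => //; exists h.
rewrite (le_trans (proj1 Ah))//.
by apply: ub_le_sup => //; exists M.
Qed.

Lemma landscape_dist_has_sup (R : realType) (Y Y' : PDgm R) :
  has_sup [set `|landscape Y k t - landscape Y' k t|
      | k in [set k : nat | (1 <= k)%N] & t in [set: R]].
Proof.
split; first by exists `|landscape Y 1 0 - landscape Y' 1 0|, 1%N => //; exists 0.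
have [M MY] := landscape_bound Y; have [M' MY'] := landscape_bound Y'.
exists (M + M') => _ [k /= k1] [t _ <-].
have [_ /andP[l0 lM]] := MY k t k1; have [_ /andP[l0' lM']] := MY' k t k1.
by rewrite (le_trans (ler_normB _ _))// !ger0_norm// lerD.
Qed.

Lemma bottleneck_dist_min (R : realType) (Y Y' : PDgm R) :
  (exists2 phi : {ffun 'I_(size Y) -> option 'I_(size Y')},
     is_matching phi & bottleneck_dist Y Y' = matching_cost phi) /\
  (forall phi : {ffun 'I_(size Y) -> option 'I_(size Y')},
     is_matching phi -> bottleneck_dist Y Y' <= matching_cost phi).
Proof.
split; last by move=> phi mphi; exact: bigmin_le_cond.
rewrite /bottleneck_dist; elim/big_ind : _ => [|x y [f mf ->] [g mg ->]|f mf].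
- exists [ffun=> None] => //.
  by apply/forallP => i; apply/forallP => i'; rewrite !ffunE eqxx.
- by rewrite minEle; case: ifP => _; [exists f | exists g].
- by exists f.
Qed.

(* Main.v *)
Require Import Defs.
From mathcomp Require Import all_boot all_order all_algebra.
From mathcomp Require Import finmap multiset.
From mathcomp Require Import fingroup perm lra.
From mathcomp Require Import all_classical all_reals all_analysis.

Set Implicit Arguments.
Unset Strict Implicit.
Unset Printing Implicit Defensive.

Import Order.TTheory GRing.Theory Num.Theory.
Local Open Scope ring_scope.

(** Let [u] and [v] be the death vectors of the birth-zero diagrams [Y] and
    [Y'].  All three distances are equal to the single number
      [DV_cost Y Y' = sup_n min (|u n - v n|, max (u n, v n) / 2)],
    in which the [n]-th term is the cheaper of two ways to reconcile the [n]-th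
    longest bars: move one death to the other, or erase both bars.  The two
    bounds then hold term by term, because [u n] and [v n] are nonnegative,
    hence [|u n - v n| <= max (u n, v n)].

    The rank function and the death vector determine each other: for a
    birth-zero diagram, [n < rank Y b d] holds exactly when
    [0 <= b <= d < u n] (lemma [ltn_rank_DV]).  Consequently:
    - [e >= 0] erodes the pair exactly when it bounds every term
      ([eroded_point_cost]), so the erosion distance is their supremum;
    - the landscape of index [n.+1] is the tent of height [u n / 2] over
      [[0, u n]] ([landscape_DV]); two tents differ by at most the [n]-th
      term, with equality at half of the larger death;
    - a matching of cost [e] makes the diagrams [e]-eroded, for arbitrary
      diagrams ([matching_eroded]), so the bottleneck distance is at least the
      supremum; it is attained by matching the [n]-th longest bars with each
      other whenever moving costs at most the supremum
      ([sorted_matching_cost]). *)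

(** * Death vectors and ranks *)

(** The default value 0 is harmless because the threshold [d] is
    nonnegative. *)
Lemma ltn_count_gt (R : realType) (s : seq R) (d : R) (n : nat) :
  0 <= d -> sorted >=%R s ->
  (n < count (fun x => (d < x)%R) s)%N = (d < nth 0 s n).
Proof.
move=> d0; elim: s n => [|x s IH] n /=.
  by move=> _; rewrite nth_nil ltNge d0.
move=> xs; have ss : sorted >=%R s := path_sorted xs.
case: (ltP d x) => dx.
  case: n => [|n] /=; first by rewrite dx addnC addn1.
  by rewrite add1n ltnS IH.
have sd : all (fun y => y <= d) s.
  have ge_x := allP (order_path_min (rev_trans le_trans) xs).
  by apply/allP => y /ge_x yx; exact: le_trans yx dx.
have -> : count (fun y => d < y) s = 0%N.
  apply/eqP; rewrite -leqn0 leqNgt -has_count; apply/negP => /hasP[y ys].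
  by rewrite ltNge (allP sd).
rewrite addn0 ltn0; apply/esym/negbTE; rewrite -leNgt.
case: n => [|n] //=; have [ns|ns] := ltnP n (size s).
  by apply: (allP sd); exact: mem_nth.
by rewrite nth_default.
Qed.

Lemma DV_ge0 (R : realType) (Y : PDgm R) (n : nat) : PDgm0 Y -> 0 <= DV Y n.
Proof.
move=> hY; rewrite /DV; set s := sort _ _.
have [ns|ns] := ltnP n (size s); last by rewrite nth_default.
have : nth 0 s n \in s by exact: mem_nth.
rewrite mem_sort => /mapP[p pY ->].
by rewrite -(hY p pY) ltW //; exact: (valP p).
Qed.

(** All bars start at 0, so those containing [[b, d]] with [0 <= b] are the
    longest ones: comparing ranks amounts to comparing death vectors entry by
    entry. *)
Lemma ltn_rank_DV (R : realType) (Y : PDgm R) (b d : R) (n : nat) :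
  PDgm0 Y -> (n < rank Y b d)%N = [&& 0 <= b, b <= d & d < DV Y n].
Proof.
move=> hY; rewrite /rank.
rewrite (@eq_in_count _ _
  (fun p => [&& 0 <= b, b <= d & d < death p])); last first.
  by move=> p pY /=; rewrite (hY p).
case: (leP 0 b) => b0 /=; last by rewrite count_pred0.
case: (leP b d) => bd /=; last by rewrite count_pred0.
rewrite -[count _ _](count_map (@death R) (fun x => d < x)).
rewrite -(count_sort >=%R) ltn_count_gt //; first exact: le_trans b0 bd.
by apply: sort_sorted => x y; exact: le_total.
Qed.

(** * The common value of the distances *)

(** The bottleneck distance between the one-point diagrams [{(0, a)}] and
    [{(0, b)}]; a death equal to 0 stands for an absent point. *)
Definition point_cost (R : realType) (a b : R) : R :=
  Num.min `|a - b| (Num.max a b / 2).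

Definition DV_cost (R : realType) (Y Y' : PDgm R) : R :=
  sup [set point_cost (DV Y n) (DV Y' n) | n in [set: nat]].

Lemma point_costC (R : realType) (a b : R) : point_cost a b = point_cost b a.
Proof. by rewrite /point_cost distrC maxC. Qed.

Lemma point_cost_le (R : realType) (a b e : R) :
  (point_cost a b <= e) = (`|a - b| <= e) || (a <= 2 * e) && (b <= 2 * e).
Proof.
by rewrite /point_cost ge_min ler_pdivrMr // ge_max mulrC.
Qed.

Lemma point_cost_ge0 (R : realType) (a b : R) :
  0 <= a -> 0 <= point_cost a b.
Proof.
by move=> a0; rewrite /point_cost le_min normr_ge0 divr_ge0 // le_max a0.
Qed.

(** The conditions on the right are what eroding one diagram by [e] asks of a
    single pair of deaths. *)
Lemma point_cost_leP (R : realType) (a b e : R) : 0 <= e ->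
  point_cost a b <= e <->
  (2 * e < a -> a - e <= b) /\ (2 * e < b -> b - e <= a).
Proof.
move=> e0; rewrite point_cost_le; split.
  by case/orP => [|/andP[ae be]]; [rewrite ler_norml => /andP[]|]; lra.
move=> [ab ba]; case: (leP a (2 * e)) => ae; case: (leP b (2 * e)) => be.
- by rewrite orbT.
- by rewrite orbF ler_norml; move: (ba be) => ?; apply/andP; split; lra.
- by rewrite orbF ler_norml; move: (ab ae) => ?; apply/andP; split; lra.
- rewrite orbF ler_norml; move: (ab ae) (ba be) => ? ?.
  by apply/andP; split; lra.
Qed.

Lemma point_cost_le_dist (R : realType) (a b : R) : point_cost a b <= `|a - b|.
Proof. by rewrite point_cost_le lexx. Qed.

Lemma dist_le_point_cost (R : realType) (a b : R) :
  0 <= a -> 0 <= b -> `|a - b| <= 2 * point_cost a b.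
Proof.
move=> a0 b0; have := lexx (point_cost a b); have := point_cost_ge0 b a0.
rewrite {3}/point_cost; set c := point_cost a b => c0.
rewrite -/(point_cost a b) point_cost_le -/c.
by case/orP => [|/andP[ac bc]]; rewrite ?ler_norml; [case/andP|]; lra.
Qed.

Lemma linf_norm_ub (R : realType) (Y Y' : PDgm R) (n : nat) :
  `|DV Y n - DV Y' n| <= linf_norm (DV Y \- DV Y').
Proof. by apply: (sup_upper_bound (linf_norm_has_sup Y Y')); exists n. Qed.

Lemma DV_cost_ub (R : realType) (Y Y' : PDgm R) (n : nat) :
  point_cost (DV Y n) (DV Y' n) <= DV_cost Y Y'.
Proof.
apply: ub_le_sup; last by exists n.
exists (linf_norm (DV Y \- DV Y')) => _ [m _ <-].
exact: le_trans (point_cost_le_dist _ _) (linf_norm_ub _ _ m).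
Qed.

Lemma DV_cost_lub (R : realType) (Y Y' : PDgm R) (e : R) :
  (forall n, point_cost (DV Y n) (DV Y' n) <= e) -> DV_cost Y Y' <= e.
Proof.
move=> le_e; apply: ge_sup; last by move=> _ [n _ <-].
by exists (point_cost (DV Y 0%N) (DV Y' 0%N)), 0%N.
Qed.

Lemma DV_cost_ge0 (R : realType) (Y Y' : PDgm R) :
  PDgm0 Y -> 0 <= DV_cost Y Y'.
Proof.
move=> hY; apply: le_trans (DV_cost_ub Y Y' 0%N).
by rewrite point_cost_ge0 // DV_ge0.
Qed.

Lemma DV_cost_linf (R : realType) (Y Y' : PDgm R) :
  PDgm0 Y -> PDgm0 Y' ->
  DV_cost Y Y' <= linf_norm (DV Y \- DV Y') <= 2 * DV_cost Y Y'.
Proof.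
move=> hY hY'; apply/andP; split.
  by apply: DV_cost_lub => n; exact: le_trans (point_cost_le_dist _ _)
    (linf_norm_ub _ _ n).
apply: ge_sup; first by have [] := linf_norm_has_sup Y Y'.
move=> _ [n _ <-] /=.
apply: le_trans (dist_le_point_cost _ _) _; rewrite ?DV_ge0 //.
by rewrite ler_pM2l ?DV_cost_ub.
Qed.

(** * Erosion distance *)

(** The intervals [(b - e, d + e)] with a nonnegative left end are those with
    [e <= b], so only deaths beyond [2 * e] are tested. *)
Lemma rank_eroded_DV (R : realType) (Y Y' : PDgm R) (e : R) :
  PDgm0 Y -> PDgm0 Y' -> 0 <= e ->
  (forall b d, b <= d -> (rank Y (b - e) (d + e) <= rank Y' b d)%N) <->
  (forall n, 2 * e < DV Y n -> DV Y n - e <= DV Y' n).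
Proof.
move=> hY hY' e0; split => [er n en|Dn b d bd].
  rewrite leNgt; apply/negP => lt_n.
  (* [d] is the smallest admissible right end (given the left end [e]) that
     the bar of index [n] in [Y'] does not outlive. *)
  pose d := Num.max (DV Y' n) e.
  have ed : e <= d by rewrite /d le_max lexx orbT.
  have dn : d < DV Y n - e by rewrite /d gt_max lt_n /=; lra.
  have : (n < rank Y (e - e) (d + e))%N.
    by rewrite ltn_rank_DV // subrr lexx /=; apply/andP; split; lra.
  move/leq_trans => /(_ _ (er _ _ ed)); rewrite ltn_rank_DV //.
  by case/and3P => _ _; rewrite ltNge /d le_max lexx.
rewrite leqNgt; apply/negP => lt_r.
have : (rank Y' b d < rank Y (b - e) (d + e))%N by [].
rewrite ltn_rank_DV // => /and3P[b0 _ dn].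
have := Dn (rank Y' b d); have : (rank Y' b d < rank Y' b d)%N = false.
  by rewrite ltnn.
rewrite ltn_rank_DV // bd (_ : 0 <= b) /=; last by lra.
by move=> /negbT; rewrite -leNgt => le_d h; move: (h ltac:(lra)); lra.
Qed.

Lemma eroded_point_cost (R : realType) (Y Y' : PDgm R) (e : R) :
  PDgm0 Y -> PDgm0 Y' -> 0 <= e ->
  eroded Y Y' e <-> forall n, point_cost (DV Y n) (DV Y' n) <= e.
Proof.
move=> hY hY' e0; split => [er n|le_e b d bd].
  apply/point_cost_leP => //; split; move: n;
    by apply/rank_eroded_DV => // b d bd; have [] := er b d bd.
split; move: b d bd; apply/rank_eroded_DV => // n;
  by have /(point_cost_leP _ _ e0)[] := le_e n.
Qed.

Lemma erosion_distE (R : realType) (Y Y' : PDgm R) :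
  PDgm0 Y -> PDgm0 Y' -> erosion_dist Y Y' = DV_cost Y Y'.
Proof.
move=> hY hY'; apply/le_anti/andP; split.
  apply: ge_inf; first by exists 0 => e [].
  split; first exact: DV_cost_ge0.
  by apply/eroded_point_cost => //; [exact: DV_cost_ge0 | exact: DV_cost_ub].
apply: lb_le_inf; first by have [] := erosion_has_inf Y Y'.
by move=> e [e0 /eroded_point_cost-/(_ hY hY' e0)]; exact: DV_cost_lub.
Qed.

(** * Landscape distance *)

Definition tent (R : realType) (a t : R) : R := Num.max 0 (Num.min t (a - t)).

Lemma landscape_DV (R : realType) (Y : PDgm R) (n : nat) (t : R) :
  PDgm0 Y -> landscape Y n.+1 t = tent (DV Y n) t.
Proof.
move=> hY; rewrite /landscape /tent; set a := DV Y n.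
have hE h : (0 <= h /\ (n < rank Y (t - h) (t + h))%N) <->
    [/\ 0 <= h, h <= t & h < a - t].
  rewrite ltn_rank_DV // -/a; split=> [[h0 /and3P[? ? ?]]|[h0 ht ha]].
    by split; lra.
  by split=> //; apply/and3P; split; lra.
set A := (X in sup X); set m := Num.min t (a - t).
have mh h : h < m -> h < t /\ h < a - t by rewrite lt_min => /andP[].
have Am h : A h -> h <= m.
  by move=> /hE[_ ht ha]; rewrite le_min ht ltW.
have [A0|/set0P[h Ah]] := eqVneq A set0.
  rewrite A0 sup0; apply/esym/max_idPl; rewrite leNgt; apply/negP => /mh[t0 ta].
  suff : A 0 by rewrite A0.
  by apply/hE; split; lra.
have [h0 _ _] := (hE h).1 Ah.
have -> : Num.max 0 m = m by apply/max_idPr; exact: le_trans h0 (Am _ Ah).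
apply/le_anti/andP; split; first by apply: ge_sup => //; exists h.
have hs : h <= sup A by apply: ub_le_sup => //; exists m.
(* The supremum need not be attained: compare with the midpoint. *)
rewrite leNgt; apply/negP => sm; pose k := (sup A + m) / 2.
have [kt ka] : k < t /\ k < a - t by apply: mh; rewrite /k; lra.
have : k <= sup A.
  apply: ub_le_sup; first by exists m.
  by apply/hE; split=> //; [rewrite /k; lra | exact: ltW].
by rewrite /k; lra.
Qed.

(** A tent is 1-Lipschitz in its death, and its values lie between 0 and half
    of its death. *)
Lemma tent_dist_le (R : realType) (a b t : R) :
  0 <= a -> 0 <= b -> `|tent a t - tent b t| <= point_cost a b.
Proof.
move=> a0 b0; have := ler_norm (a - b); have := ler_norm (b - a).
rewrite (distrC b) /point_cost le_min => ba ab.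
have am : a <= Num.max a b by rewrite le_max lexx.
have bm : b <= Num.max a b by rewrite le_max lexx orbT.
rewrite ler_pdivlMr // /tent; case: (leP t (a - t)) => ?;
  case: (leP t (b - t)) => ?; case: (leP 0 t) => ?;
  case: (leP 0 (a - t)) => ?; case: (leP 0 (b - t)) => ?;
  (apply/andP; split; [rewrite ler_norml; apply/andP; split; lra|]);
  rewrite -ler_pdivlMr // ler_norml; apply/andP; split; lra.
Qed.

Lemma tent_dist_peak (R : realType) (a b : R) : 0 <= b -> b <= a ->
  `|tent a (a / 2) - tent b (a / 2)| = point_cost a b.
Proof.
move=> b0 ba; rewrite /point_cost (max_idPl ba) (@ger0_norm _ (a - b)) ?subr_ge0 //.
rewrite /tent (_ : a - a / 2 = a / 2); last by lra.
rewrite minxx (max_idPr _); last by lra.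
rewrite (min_idPr _); last by lra.
case: (leP (a - b) (a / 2)) => ?; case: (leP 0 (b - a / 2)) => ?;
  rewrite ger0_norm; lra.
Qed.

Lemma landscape_distE (R : realType) (Y Y' : PDgm R) :
  PDgm0 Y -> PDgm0 Y' -> landscape_dist Y Y' = DV_cost Y Y'.
Proof.
move=> hY hY'; apply/le_anti/andP; split.
  apply: ge_sup; first by have [] := landscape_dist_has_sup Y Y'.
  move=> _ [[|n] //= _] [t _ <-]; rewrite !landscape_DV //.
  by apply: le_trans (DV_cost_ub _ _ n); apply: tent_dist_le; exact: DV_ge0.
apply: DV_cost_lub => n.
apply: (@le_trans _ _ `|landscape Y n.+1 (Num.max (DV Y n) (DV Y' n) / 2)
                      - landscape Y' n.+1 (Num.max (DV Y n) (DV Y' n) / 2)|).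
  rewrite !landscape_DV //; case: (leP (DV Y n)) => [|/ltW] ab; last first.
    by rewrite tent_dist_peak // DV_ge0.
  by rewrite distrC tent_dist_peak ?DV_ge0 // point_costC.
apply: (sup_upper_bound (landscape_dist_has_sup Y Y')).
by exists n.+1 => //; eexists.
Qed.

(** * Bottleneck distance *)

(** A relation is used instead of a function because the counting argument runs
    along a matching in both directions, and the inverse of a partial injection
    is only available as a relation. *)
Lemma leq_card_injrel (I J : finType) (r : I -> J -> bool) (A : pred I)
    (B : pred J) :
  (forall i i' j, r i j -> r i' j -> i = i') ->
  (forall i, A i -> exists2 j, B j & r i j) -> (#|A| <= #|B|)%N.
Proof.
move=> r_inj AB.
have [f fP] : exists f : I -> option J,
    forall i, A i -> exists2 j, f i = Some j & B j && r i j.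
  exists (fun i => [pick j | B j && r i j]) => i /AB[j Bj rij].
  by case: pickP => [k Bk|/(_ j)]; [exists k | rewrite Bj rij].
have f_inj : {in A &, injective f}.
  move=> i i' Ai Ai'; have [j -> /andP[_ rij]] := fP i Ai.
  have [j' -> /andP[_ rij']] := fP i' Ai'.
  by case=> jj'; apply: r_inj rij _; rewrite jj'.
have Some_inj : injective (@Some J) by move=> ? ? [].
rewrite -(fintype.card_in_image f_inj) -(fintype.card_image Some_inj B).
apply: subset_leq_card; apply/fintype.subsetP => _ /fintype.imageP[i Ai ->].
by have [j -> /andP[Bj _]] := fP i Ai; exact: fintype.image_f.
Qed.

Lemma rank_card (R : realType) (Y : PDgm R) (b d : R) :
  rank Y b d = #|[pred i : 'I_(size Y) |
    [&& birth (pt i) <= b, b <= d & d < death (pt i)]]|.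
Proof. by rewrite /rank -sum1_count big_tnth -sum1_card. Qed.

Section Matching.
Variables (R : realType) (Y Y' : PDgm R).
Implicit Type phi : {ffun 'I_(size Y) -> option 'I_(size Y')}.

Lemma matching_cost_ge0 phi : 0 <= matching_cost phi.
Proof. by rewrite /matching_cost le_max bigmax_ge_id. Qed.

Lemma matching_cost_leP phi (e : R) : 0 <= e ->
  matching_cost phi <= e <->
  [/\ forall i j, phi i = Some j -> dinf (pt i) (pt j) <= e,
      forall i, phi i = None -> death (pt i) - birth (pt i) <= 2 * e &
      forall j, (forall i, phi i != Some j) ->
        death (pt j) - birth (pt j) <= 2 * e].
Proof.
move=> e0; rewrite /matching_cost !ge_max; split.
  case/and3P => /bigmax_leP[_ mS] /bigmax_leP[_ mN] /bigmax_leP[_ mN'].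
  split=> [i j ij|i iN|j jN].
  - by apply: (mS (i, j)); rewrite /= ij.
  - by rewrite mulrC -ler_pdivrMr // mN // iN.
  - rewrite mulrC -ler_pdivrMr // mN' //.
    by apply/codomP => -[i /esym/eqP]; rewrite (negbTE (jN i)).
move=> [mS mN mN']; apply/and3P; split; apply/bigmax_leP; split => //.
- by move=> [i j] /= /eqP; exact: mS.
- by move=> i /eqP iN; rewrite ler_pdivrMr // mulrC mN.
- move=> j jN; rewrite ler_pdivrMr // mulrC mN' // => i.
  by apply: contra jN => /eqP <-; exact: codom_f.
Qed.

(** A bar that survives shrinking both of its ends by the cost [e] is longer
    than [2 * e], hence it is matched, and its partner contains what remains
    after the shrinking. *)
Lemma matching_eroded phi : is_matching phi -> eroded Y Y' (matching_cost phi).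
Proof.
move=> mphi b d bd; set e := matching_cost phi.
have e0 : 0 <= e := matching_cost_ge0 phi.
have [mS mN mN'] := (matching_cost_leP phi e0).1 (lexx _).
have close i j : phi i = Some j -> 
    [/\ birth (pt i) - e <= birth (pt j), birth (pt j) - e <= birth (pt i),
        death (pt i) - e <= death (pt j) & death (pt j) - e <= death (pt i)].
  move=> /mS; rewrite /dinf ge_max !ler_norml => /andP[/andP[? ?] /andP[? ?]].
  by split; lra.
rewrite !rank_card; split.
  apply: (leq_card_injrel (r := fun i j => phi i == Some j)).
    move=> i i' j /eqP ij /eqP i'j; have /forallP/(_ i)/forallP/(_ i') := mphi.
    by rewrite ij i'j eqxx /= => /eqP.
  move=> i /= /and3P[bi _ di]; case ij: (phi i) => [j|]; last first.
    by move: (mN i ij); lra.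
  by exists j => //; have [? ? ? ?] := close i j ij; apply/and3P; split; lra.
apply: (leq_card_injrel (r := fun j i => phi i == Some j)).
  by move=> j j' i /eqP -> /eqP[].
move=> j /= /and3P[bj _ dj]; case: (pickP (fun i => phi i == Some j)).
  move=> i ij; exists i => //.
  by have [? ? ? ?] := close i j (eqP ij); apply/and3P; split; lra.
by move=> jN; have := mN' j (fun i => negbT (jN i)); lra.
Qed.

End Matching.

(** The permutation is needed because points are labelled in the arbitrary
    order of the multiset enumeration, not by decreasing death. *)
Lemma DV_perm (R : realType) (Y : PDgm R) :
  exists p : {perm 'I_(size Y)}, forall i, death (pt i) = DV Y (p i).
Proof.
have /tuple_permP[p sE] :
    perm_eq (sort >=%R [seq death q | q <- Y]) (map_tuple (@death R) (in_tuple Y)).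
  by rewrite perm_sort.
exists (p^-1)%g => i; rewrite /DV sE.
rewrite -[i in LHS](permKV p) -(tnth_map (@death R)).
by rewrite (nth_map (p^-1 i)%g) ?size_enum_ord // nth_ord_enum.
Qed.

(** The [n]-th longest bars are matched with each other when their deaths differ
    by at most [DV_cost Y Y'].  Otherwise the [n]-th term of the supremum is the
    cost of erasing, so erasing both stays within the bound. *)
Lemma sorted_matching_cost (R : realType) (Y Y' : PDgm R) :
  PDgm0 Y -> PDgm0 Y' ->
  exists2 phi : {ffun 'I_(size Y) -> option 'I_(size Y')},
    is_matching phi & matching_cost phi <= DV_cost Y Y'.
Proof.
move=> hY hY'; have [p pE] := DV_perm Y; have [q qE] := DV_perm Y'.
have birth0 (Z : PDgm R) (hZ : PDgm0 Z) (i : 'I_(size Z)) : birth (pt i) = 0.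
  by apply: hZ; exact: mem_tnth.
pose near n := `|DV Y n - DV Y' n| <= DV_cost Y Y'.
have far n : ~~ near n ->
    DV Y n <= 2 * DV_cost Y Y' /\ DV Y' n <= 2 * DV_cost Y Y'.
  have := DV_cost_ub Y Y' n; rewrite point_cost_le -/(near n).
  by case: (near n) => //= /andP[].
pose phi : {ffun 'I_(size Y) -> option 'I_(size Y')} :=
  [ffun i => if near (p i) then omap (q^-1)%g (insub (p i : nat)) else None].
have phiP i j : phi i = Some j <-> near (p i) /\ (p i : nat) = q j.
  rewrite ffunE; case: (near _); last by split => // -[].
  split => [|[_ ij]]; first by case: insubP => //= k _ <- [<-]; rewrite permKV.
  by rewrite ij valK /= permK.
have phiN i : phi i = None -> near (p i) -> (size Y' <= p i)%N.
  by move=> + near_i; rewrite ffunE near_i; case: insubP => //=; rewrite -leqNgt.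
have DV_size (Z : PDgm R) n : (size Z <= n)%N -> DV Z n = 0.
  by move=> Zn; rewrite /DV nth_default // size_sort size_map.
exists phi.
  apply/forallP => i; apply/forallP => i'; apply/implyP => /andP[/eqP ii'].
  case ij: (phi i) ii' => [j|] // i'j _; apply/eqP/(@perm_inj _ p)/val_inj.
  by have [[_ /= ->] [_ /= ->]] := ((phiP i j).1 ij, (phiP i' j).1 (esym i'j)).
have c0 : 0 <= DV_cost Y Y' by exact: DV_cost_ge0.
apply: (matching_cost_leP phi c0).2; split => [i j /phiP[near_i ij]|i iN|j jN].
- by rewrite /dinf !birth0 // subrr normr0 ge_max c0 pE qE -ij.
- rewrite birth0 // subr0 pE; have [near_i|/far[]//] := boolP (near (p i)).
  (* The bar has no counterpart, so its whole length is within the bound. *)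
  move: (near_i); rewrite /near (DV_size _ _ (phiN i iN near_i)) subr0.
  by rewrite ler_norml => /andP[]; lra.
- rewrite birth0 // subr0 qE; have [near_j|/far[]//] := boolP (near (q j)).
  have Yj : (size Y <= q j)%N.
    rewrite leqNgt; apply/negP => jY.
    have := jN (p^-1 (Ordinal jY))%g; rewrite (phiP _ j).2 ?eqxx //.
    by rewrite permKV.
  move: near_j; rewrite /near (DV_size _ _ Yj) sub0r normrN.
  by rewrite ler_norml => /andP[]; lra.
Qed.

Lemma bottleneck_distE (R : realType) (Y Y' : PDgm R) :
  PDgm0 Y -> PDgm0 Y' -> bottleneck_dist Y Y' = DV_cost Y Y'.
Proof.
move=> hY hY'; have [[phi mphi phiE] dist_le] := bottleneck_dist_min Y Y'.
apply/le_anti/andP; split.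
  have [psi mpsi psi_le] := sorted_matching_cost hY hY'.
  exact: le_trans (dist_le psi mpsi) psi_le.
rewrite phiE; apply: DV_cost_lub; apply/eroded_point_cost => //.
  exact: matching_cost_ge0.
exact: matching_eroded.
Qed.

Theorem corollary4p18 (R : realType) (Y Y' : PDgm R)
    (hY : PDgm0 Y) (hY' : PDgm0 Y') :
  (landscape_dist Y Y' = bottleneck_dist Y Y' /\
   bottleneck_dist Y Y' = erosion_dist Y Y') /\
  (landscape_dist Y Y' <= linf_norm (DV Y \- DV Y')
     <= 2 * landscape_dist Y Y') /\
  (bottleneck_dist Y Y' <= linf_norm (DV Y \- DV Y')
     <= 2 * bottleneck_dist Y Y') /\
  (erosion_dist Y Y' <= linf_norm (DV Y \- DV Y')
     <= 2 * erosion_dist Y Y').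
Proof.
rewrite landscape_distE // bottleneck_distE // erosion_distE //.
by do !split; exact: DV_cost_linf.
Qed.
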